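(* Let $k\geq r\geq2$, and let $G$ be a $k$-partite $r$-graph of order $n$. For every real $p>1$, \[ \lambda^{(p)}(G)<\lambda^{(p)}(T_k^r(n)), \] unless $G=T_k^r(n)$ (up to isomorphism).
   Context: An $r$-graph of order $n$ is an $r$-uniform hypergraph with vertex set $[n]$. Its polynomial form is $P_G([x_i])=r!\sum_{\{i_1,\ldots,i_r\}\in E(G)}x_{i_1}\cdots x_{i_r}$, and for real $p\geq1$ its $p$-spectral radius is $\lambda^{(p)}(G)=\max_{|x_1|^p+\cdots+|x_n|^p=1}P_G([x_i])$. An $r$-graph is $k$-partite if its vertex set can be partitioned into $k$ sets so that each edge contains at most one vertex from each set; an edge-maximal $k$-partite $r$-graph is complete $k$-partite. $T_k^r(n)$ denotes the complete $k$-partite $r$-graph of order $n$ whose $k$ parts have sizes $\lfloor n/k\rfloor$ or $\lceil n/k\rceil$. *)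

(* Defs.v *)
From HB Require Import structures.
From mathcomp Require Import all_boot all_order all_algebra all_fingroup.
From mathcomp Require Import all_classical all_reals all_analysis.
From mathcomp Require Import zify.

Set Implicit Arguments.
Unset Strict Implicit.
Unset Printing Implicit Defensive.

Import Order.TTheory GRing.Theory Num.Theory.
Import numFieldNormedType.Exports.

Local Open Scope classical_set_scope.
Local Open Scope ring_scope.

Record uhypergraph (r n : nat) := UHypergraph {
  edges : {set {set 'I_n}};
  edges_uniform : forall e, e \in edges -> #|e| = r }.

Definition uhypergraph_iso (r n : nat) (G H : uhypergraph r n) : Prop :=
  exists s : {perm 'I_n}, edges H = [set s @: (e : {set 'I_n}) | e in edges G]%SET.

(* Partitions into k sets, empty parts allowed: for n < k the parts of
   T_k^r(n) have sizes 0 and 1. *)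
Definition kpartition (n k : nat) (V : 'I_k -> {set 'I_n}) : Prop :=
  forall i : 'I_n, exists! j : 'I_k, i \in V j.

Definition crosses (n k : nat) (V : 'I_k -> {set 'I_n}) (e : {set 'I_n}) : bool :=
  [forall j : 'I_k, (#|e :&: V j| <= 1)%N].

Definition kpartite (k r n : nat) (G : uhypergraph r n) : Prop :=
  exists V : 'I_k -> {set 'I_n},
    kpartition V /\ forall e, e \in edges G -> crosses V e.

Lemma complete_kpartite_uniform (k r n : nat) (V : 'I_k -> {set 'I_n}) e :
  e \in [set e : {set 'I_n} | (#|e| == r) && crosses V e]%SET -> #|e| = r.
Proof. by rewrite inE => /andP[/eqP]. Qed.

Definition complete_kpartite (k r n : nat) (V : 'I_k -> {set 'I_n}) : uhypergraph r n :=
  UHypergraph (@complete_kpartite_uniform k r n V).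

(* The parts are the residue classes modulo k; see card_turan_part. *)
Definition turan_part (k n : nat) (j : 'I_k) : {set 'I_n} :=
  [set i : 'I_n | (i %% k)%N == j]%SET.

Definition turan (k r n : nat) : uhypergraph r n := complete_kpartite r (@turan_part k n).

Definition polyform (R : realType) (r n : nat) (G : uhypergraph r n) (x : 'rV[R]_n) : R :=
  (r`!)%:R * \sum_(e in edges G) \prod_(i in e) x ord0 i.

Definition psphere (R : realType) (n : nat) (p : R) : set 'rV[R]_n :=
  [set x | \sum_(i < n) `|x ord0 i| `^ p = 1].

(* The maximum over the sphere, written as a supremum; it is attained for n > 0,
   see pspectral_radius_max. *)
Definition pspectral_radius (R : realType) (r n : nat) (p : R) (G : uhypergraph r n) : R :=
  sup (polyform G @` @psphere R n p).

Lemma kpartition_turan (k n : nat) : (0 < k)%N -> kpartition (@turan_part k n).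
Proof.
move=> k0 i; exists (Ordinal (ltn_pmod i k0)); split; first by rewrite inE.
by move=> j; rewrite inE => /eqP ij; apply/val_inj.
Qed.

Lemma card_turan_part (k n : nat) (j : 'I_k) :
  #|turan_part n j| = (n %/ k)%N \/ #|turan_part n j| = ((n + k.-1) %/ k)%N.
Proof.
have k0 : (0 < k)%N by apply: leq_ltn_trans (ltn_ord j).
have -> : #|turan_part n j| = ((n + (k.-1 - j)) %/ k)%N.
  rewrite -sum1_card big_mkcond /=.
  rewrite (eq_bigr (fun i : 'I_n => nat_of_bool ((i %% k)%N == j))); last first.
    by move=> i _; rewrite inE; case: eqP.
  elim: n => [|n IHn].
    by rewrite big_ord0 add0n divn_small// ; have := ltn_ord j; lia.
  rewrite big_ord_recr /= IHn addSn divnS// addnC; congr (_ + _)%N.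
  have jk := ltn_ord j.
  have -> : (n + (k.-1 - j)).+1 = (n + (k - j))%N by lia.
  congr nat_of_bool; apply/eqP/idP => [<-|].
    rewrite {1}(divn_eq n k) -addnA dvdn_addr ?dvdn_mull//.
    by rewrite subnKC// ltnW// ltn_pmod.
  have := ltn_pmod n k0.
  rewrite {2}(divn_eq n k) -addnA dvdn_addr ?dvdn_mull// => nk /dvdnP[q qE].
  case: q qE => [|[|q]] qE; lia.
have jk := ltn_ord j.
have le1 : (n %/ k <= (n + (k.-1 - j)) %/ k)%N by apply: leq_div2r; lia.
have le2 : ((n + (k.-1 - j)) %/ k <= (n + k.-1) %/ k)%N by apply: leq_div2r; lia.
have le3 : ((n + k.-1) %/ k <= (n %/ k).+1)%N.
  have -> : (n %/ k).+1 = ((n + k) %/ k)%N by rewrite divnDr// divnn k0 addn1.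
  by apply: leq_div2r; lia.
lia.
Qed.

Lemma continuous_normpow (R : realType) (p : R) : 0 < p ->
  continuous (fun x : R => `|x| `^ p).
Proof.
move=> p0 x; have [->|x0] := eqVneq x 0.
  apply/cvgrPdist_lt => e e0.
  rewrite normr0 powR0 ?gt_eqF//.
  have d0 : 0 < e `^ p^-1 by rewrite powR_gt0.
  exists (e `^ p^-1) => // y; rewrite /ball_ /= sub0r normrN => yd.
  rewrite sub0r normrN ger0_norm ?powR_ge0//.
  have -> : e = (e `^ p^-1) `^ p by rewrite -powRrM mulVf ?gt_eqF// powRr1// ltW.
  by apply: gt0_ltr_powR => //; rewrite nnegrE// powR_ge0.
apply: (@continuous_comp _ _ _ (fun x : R => `|x|) (fun y => y `^ p)).
  exact: norm_continuous.
apply/differentiable_continuous/derivable1_diffP/derivable_powR.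
by rewrite in_itv/= andbT normr_gt0.
Qed.

Lemma continuous_polyform (R : realType) (r n : nat) (G : uhypergraph r n) :
  continuous (@polyform R r n G).
Proof.
have c : continuous (fun x : 'rV[R]_n =>
    \sum_(e in edges G) \prod_(i in e) x ord0 i : R).
  apply: continuous_big => [|e _]; first exact: add_continuous.
  apply: continuous_big => [|i _]; first exact: mul_continuous.
  exact: coord_continuous.
move=> x; apply: (@continuousM R _ (cst (r`!)%:R) _ x) (c x); exact: cst_continuous.
Qed.

Lemma pspectral_radius_max (R : realType) (r n : nat) (p : R) (G : uhypergraph r n) :
  (0 < n)%N -> 1 <= p ->
  exists2 x, psphere p x &
    pspectral_radius p G = polyform G x /\
    forall y, psphere p y -> polyform G y <= polyform G x.
Proof.
move=> n0 p1.
have p0 : 0 < p by apply: lt_le_trans p1.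
have cN : continuous (fun x : 'rV[R]_n => \sum_(i < n) `|x ord0 i| `^ p).
  apply: continuous_big; first exact: add_continuous.
  move=> i _ x.
  apply: (@continuous_comp _ _ _ (fun x : 'rV[R]_n => x ord0 i)
    (fun y : R => `|y| `^ p)); first exact: coord_continuous.
  exact: continuous_normpow.
have nonempty : @psphere R n p !=set0.
  pose i0 := Ordinal n0.
  exists (\row_i (i == i0)%:R); rewrite /psphere /= (bigD1 i0)//= big1 => [|i ii0].
    by rewrite mxE eqxx normr1 powR1 addr0.
  by rewrite mxE (negbTE ii0) normr0 powR0// gt_eqF.
have cpt : compact (@psphere R n p).
  apply: bounded_closed_compact.
    exists 1; split; first exact: num_real.
    move=> M M1 x /= xS; rewrite [leLHS]/Num.norm /= mx_normrE.
    apply: bigmax_le => [|[i j] _]; first exact: ltW (lt_trans ltr01 M1).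
    rewrite /= (ord1 i); apply: le_trans (ltW M1).
    rewrite leNgt; apply/negP => x1.
    have : \sum_(i < n) `|x ord0 i| `^ p > 1.
      rewrite (bigD1 j)//= -[ltLHS]addr0; apply: ltr_leD.
        by apply: (lt_le_trans x1); apply: le1r_powR => //; exact: ltW.
      by apply: sumr_ge0 => l _; exact: powR_ge0.
    by rewrite xS ltxx.
  rewrite (_ : psphere p = (fun x => \sum_(i < n) `|x ord0 i| `^ p) @^-1` [set 1])//.
  by apply: preimage_closed => [x _|]; [exact: cN|exact: closed_eq].
have [x /set_mem xS xmax] := compact_EVT_max nonempty cpt
  (continuous_subspaceT (@continuous_polyform R r n G)).
have xmax' y : psphere p y -> polyform G y <= polyform G x.
  by move=> yS; apply: xmax; exact: mem_set.
exists x => //; split=> //; apply/eqP; rewrite eq_le; apply/andP; split.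
  apply: ge_sup; first by exists (polyform G x), x.
  by move=> _ [y yS <-]; exact: xmax'.
apply: ub_le_sup; last by exists x.
by exists (polyform G x) => _ [y yS <-]; exact: xmax'.
Qed.

(* Main.v *)
Require Import Defs.
From mathcomp Require Import all_boot all_order all_algebra all_fingroup.
From mathcomp Require Import all_classical all_reals all_analysis.
From mathcomp Require Import zify ring lra.

(** If [c] is a colouring of the vertices and [s_j] the total weight of colour
    [j], the polynomial form of the complete multipartite graph of [c] is
    [r!] times the elementary symmetric polynomial [e_r(s_1, ..., s_k)], which
    is [A + B (s_a + s_b) + C s_a s_b] in any two of its variables.  When the
    class [a] has at least two vertices more than the class [b], moving a vertex
    from [a] to [b] and levelling the weights keeps [s_a + s_b], does not
    decrease [s_a s_b] nor increase the [p]-norm, and improves one of the two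
    strictly; the only analytic input is that the graph of [y |-> y^p] lies
    above its tangents.  Hence a colouring of largest radius is balanced, so its
    graph is the Turan graph.  A maximizer of a complete multipartite graph has
    positive entries, so a proper subgraph has a strictly smaller radius. *)

Set Implicit Arguments.
Unset Strict Implicit.
Unset Printing Implicit Defensive.

Import Order.TTheory GRing.Theory Num.Theory.

Local Open Scope ring_scope.

(** * Elementary symmetric polynomials on a set of indices *)

Section ElementarySymmetric.
Context {R : comNzRingType} {I : finType}.
Implicit Types (m : nat) (D : {set I}) (s t : I -> R).

Definition elem_sym m D s : R :=
  \sum_(J : {set I} | (J \subset D) && (#|J| == m)) \prod_(j in J) s j.

Lemma eq_elem_sym m D s t : {in D, s =1 t} -> elem_sym m D s = elem_sym m D t.
Proof.
move=> st; apply: eq_bigr => J /andP[JD _]; apply: eq_bigr => j jJ.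
exact/st/(fintype.subsetP JD).
Qed.

(** The index sets are split by whether they contain [a]; those that do are [a |: J] for a unique
    [J] inside [D] with one element fewer. *)
Lemma elem_symU1 m D s a : a \notin D ->
  elem_sym m.+1 (a |: D)%SET s = elem_sym m.+1 D s + s a * elem_sym m D s.
Proof.
move=> aD; rewrite /elem_sym (bigID (fun J : {set I} => a \in J)) /= addrC.
congr (_ + _).
  apply: eq_bigl => J; rewrite andbAC; congr (_ && _).
  apply/andP/idP => [[/fintype.subsetP JD aJ]|/fintype.subsetP JD].
    apply/fintype.subsetP => j jJ; have := JD j jJ; rewrite !inE => /orP[/eqP ja|//].
    by rewrite -ja jJ in aJ.
  by split; [apply/fintype.subsetP => j /JD; rewrite !inE orbC => ->|apply: contra aD => /JD].
rewrite mulr_sumr.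
rewrite (reindex_onto (fun J => a |: J)%SET (fun J => J :\ a)%SET) /=; last first.
  by move=> J /andP[_ aJ]; rewrite finset.setD1K.
have aN (J : {set I}) : J \subset D -> a \notin J by move=> /fintype.subsetP JD; apply: contra aD => /JD.
rewrite (eq_bigl (fun J : {set I} => (J \subset D) && (#|J| == m))); last first.
  move=> J; apply/idP/idP => [/andP[/andP[/andP[JD Jm] _] /eqP aJ]|/andP[JD Jm]].
    have aJ' : a \notin J by rewrite -aJ !inE eqxx.
    move: Jm; rewrite cardsU1 aJ' eqSS => ->; rewrite andbT.
    apply/fintype.subsetP => j jJ; have := fintype.subsetP JD j; rewrite !inE jJ orbT.
    by move=> /(_ isT)/orP[/eqP ja|//]; rewrite -ja jJ in aJ'.
  rewrite cardsU1 aN// eqSS Jm setU11 finset.setUS// finset.setU1K ?eqxx//.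
  exact: aN.
by apply: eq_bigr => J /andP[JD _]; rewrite big_setU1 ?aN.
Qed.

Lemma elem_sym_split2 m s a b : a != b -> let D := (~: [set a; b])%SET in
  elem_sym m.+2 [set: I] s =
  elem_sym m.+2 D s + (s a + s b) * elem_sym m.+1 D s + s a * s b * elem_sym m D s.
Proof.
move=> ab D.
have bD : b \notin D by rewrite !inE eqxx orbT.
have abD : a \notin (b |: D)%SET by rewrite !inE eqxx (negbTE ab).
have -> : [set: I]%SET = (a |: (b |: D))%SET.
  by apply/setP => i; rewrite !inE; do 2?case: eqP.
rewrite !elem_symU1//; ring.
Qed.

End ElementarySymmetric.

(** * Tangents of the power function and the rebalancing of two blocks *)

(** This is Young's inequality for [y] and [w ^ (p - 1)] with the conjugate exponents [p] and
    [p / (p - 1)], multiplied by [p]. *)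
Lemma tangent_powR_le {R : realType} (p y w : R) : 1 < p -> 0 <= y -> 0 <= w ->
  w `^ p + p * w `^ (p - 1) * (y - w) <= y `^ p.
Proof.
move=> p1 y0 w0; have p0 : 0 < p by lra.
have [->|wN] := eqVneq w 0.
  rewrite !powR0 ?gt_eqF ?subr_gt0//.
  by rewrite mulr0 mul0r addr0 powR_ge0.
have w1 : w `^ p = w * w `^ (p - 1).
  by rewrite mulrC -{3}(powRr1 w0) -powRD ?subrK// wN implybT.
have q0 : 0 < p / (p - 1) by apply: divr_gt0; lra.
have := @conjugate_powR R y (w `^ (p - 1)) p (p / (p - 1)) y0 (powR_ge0 _ _) p0 q0.
have -> : p^-1 + (p / (p - 1))^-1 = 1 by field; lra.
rewrite -powRrM.
have -> : (p - 1) * (p / (p - 1)) = p by field; lra.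
move=> /(_ erefl); rewrite invf_div => H.
have := ler_wpM2l (ltW p0) H.
have -> : p * (y `^ p / p + w `^ p * ((p - 1) / p)) = y `^ p + w `^ p * (p - 1).
  by field; lra.
rewrite w1; nra.
Qed.

(* At [y], the tangent at the midpoint of [y] and [w] lies above the tangent at [w]. *)
Lemma tangent_powR_lt {R : realType} (p y w : R) : 1 < p -> 0 <= y -> 0 <= w -> y != w ->
  w `^ p + p * w `^ (p - 1) * (y - w) < y `^ p.
Proof.
move=> p1 y0 w0 yw; pose m := (y + w) / 2.
have m0 : 0 <= m by rewrite /m; lra.
have t1 := tangent_powR_le p1 y0 m0.
have t2 := tangent_powR_le p1 m0 w0.
apply: lt_le_trans t1; apply: lt_le_trans (lerD t2 (lexx _)).
have -> : m - w = (y - w) / 2 by rewrite /m; field.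
have -> : y - m = (y - w) / 2 by rewrite /m; field.
have : 0 < (m `^ (p - 1) - w `^ (p - 1)) * (y - w).
  have pm : 0 < p - 1 by lra.
  have [yltw|wlty|] := ltgtP y w; last by move/eqP; rewrite (negbTE yw).
    rewrite nmulr_rgt0; first lra.
    by rewrite subr_lt0; apply: gt0_ltr_powR; rewrite ?nnegrE// /m; lra.
  apply: mulr_gt0; last lra.
  by rewrite subr_gt0; apply: gt0_ltr_powR; rewrite ?nnegrE// /m; lra.
have p0 : 0 < p by lra.
move=> /(mulr_gt0 p0); nra.
Qed.

(** Summing the tangents at one point [w] gives a lower bound that depends on the weights only
    through their total and their number, so that levelled and original weights can be compared. *)
Lemma sum_powR_tangent {R : realType} (I : finType) (A : {set I}) (p w : R)
    (x : I -> R) : 1 < p -> 0 <= w -> (forall i, 0 <= x i) ->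
  #|A|%:R * w `^ p + p * w `^ (p - 1) * (\sum_(i in A) x i - #|A|%:R * w)
    <= \sum_(i in A) x i `^ p.
Proof.
move=> p1 w0 x0; rewrite !mulr_natl -!sumr_const -sumrB mulr_sumr -big_split /=.
by apply: ler_sum => i _; exact: tangent_powR_le.
Qed.

Lemma sum_powR_tangent_lt {R : realType} (I : finType) (A : {set I}) (p w : R)
    (x : I -> R) i0 : 1 < p -> 0 <= w -> (forall i, 0 <= x i) ->
  i0 \in A -> x i0 != w ->
  #|A|%:R * w `^ p + p * w `^ (p - 1) * (\sum_(i in A) x i - #|A|%:R * w)
    < \sum_(i in A) x i `^ p.
Proof.
move=> p1 w0 x0 i0A xi0; rewrite !mulr_natl -!sumr_const -sumrB mulr_sumr.
rewrite -big_split /= (bigD1 i0)//= [ltRHS](bigD1 i0)//=.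
apply: ltr_leD; first exact: tangent_powR_lt.
by apply: ler_sum => i _; exact: tangent_powR_le.
Qed.

(* [alpha] and [beta] are the block sizes after one vertex has moved from the
   larger block [A] to the smaller block [B], and [v], [w] the constant weights
   to be put on the new blocks. *)
Lemma rebalance_blocks {R : realType} (I : finType) (A B : {set I}) (p : R)
    (x : I -> R) (alpha := (#|A|.-1)%:R : R) (beta := (#|B|.+1)%:R : R)
    (sA := \sum_(i in A) x i) (sB := \sum_(i in B) x i) :
  1 < p -> (forall i, 0 < x i) -> [disjoint A & B] -> (#|B|.+1 < #|A|)%N ->
  exists v w : R, [/\ 0 < v /\ 0 < w, alpha * v + beta * w = sA + sB,
    sA * sB <= (alpha * v) * (beta * w),
    alpha * v `^ p + beta * w `^ p <=
      \sum_(i in A) x i `^ p + \sum_(i in B) x i `^ p &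
    sA * sB < (alpha * v) * (beta * w) \/
    alpha * v `^ p + beta * w `^ p <
      \sum_(i in A) x i `^ p + \sum_(i in B) x i `^ p].
Proof.
move=> p1 x0 dAB BA.
have x0' i : 0 <= x i by exact: ltW.
have p0 : 0 < p by lra.
have cA : #|A|%:R = alpha + 1 by rewrite /alpha natr1 prednK//; lia.
have cB : #|B|%:R = beta - 1 by rewrite /beta -natr1 addrK.
have b1 : 1 <= beta by rewrite /beta ler1n.
have ab : beta <= alpha by rewrite /alpha /beta ler_nat; lia.
have sA0 : 0 < sA.
  have /card_gt0P[i iA] : (0 < #|A|)%N by lia.
  rewrite /sA (bigD1 i)//=; apply: ltr_wpDr => //.
  exact: sumr_ge0.
have sB0 : 0 <= sB by exact: sumr_ge0.
have xU (F : I -> R) :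
    \sum_(i in (A :|: B)%SET) F i = \sum_(i in A) F i + \sum_(i in B) F i.
  by rewrite -bigU//; apply: eq_bigl => i; rewrite !inE.
have cU : #|(A :|: B)%SET|%:R = alpha + beta :> R.
  by rewrite -sumr_const xU !sumr_const cA cB; ring.
pose S := sA + sB; pose N := alpha + beta.
have N0 : 0 < N by rewrite /N; lra.
(* The larger block need not carry the larger total, and only [sA + sB] and [sA * sB] matter. The
   larger total is therefore assigned to the larger new block. *)
pose M := Num.max sA sB; pose m := Num.min sA sB.
have Mm : M + m = S by rewrite /M /m addr_max_min.
have MmM : M * m = sA * sB by rewrite /M /m; case: (leP sA sB) => _; ring.
have mM : m <= M by rewrite /m /M le_max ge_min lexx.
have m0 : 0 <= m by rewrite le_min sB0 ltW.
(* [S / N] is the common level of all weights. In this case every weight is set to it: the new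
   totals lie between [m] and [M] and have the same sum, so their product is at least [M * m]. *)
have [MS|MS] := leP (S * alpha / N) M.
  pose v := S / N.
  have v0 : 0 < v by apply: divr_gt0 => //; rewrite /S; lra.
  have vN : N * v = S by rewrite /v; field; rewrite gt_eqF.
  have vM : alpha * v <= M by move: MS; rewrite /v mulrAC mulrC mulrA.
  have vm : m <= beta * v by move: vN; rewrite /N; nra.
  have prodE : (alpha * v) * (beta * v) - sA * sB =
      (M - alpha * v) * (alpha * v - m).
    rewrite -MmM; have -> : beta * v = M + m - alpha * v.
      by rewrite Mm -vN /N; ring.
    ring.
  have avm : m <= alpha * v by apply: (le_trans vm); rewrite ler_pM2r.
  have eU : #|(A :|: B)%SET|%:R * v `^ p + p * v `^ (p - 1) *
      (\sum_(i in (A :|: B)%SET) x i - #|(A :|: B)%SET|%:R * v) =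
      alpha * v `^ p + beta * v `^ p.
    by rewrite cU xU -/sA -/sB -/S -/N vN /N; ring.
  have tU := sum_powR_tangent (A :|: B)%SET p1 (ltW v0) x0'.
  rewrite eU xU in tU.
  exists v, v; split=> //.
  - by rewrite -/S -vN /N; ring.
  - by rewrite -subr_ge0 prodE mulr_ge0// subr_ge0.
  (* A weight off the level makes its tangent inequality strict. If all weights equal [v], moving
     the vertex raises the product by [(alpha - beta + 1) * (v * v)]. *)
  - have [/existsP[i /andP[iU xi]]|/existsPn xv] :=
      boolP [exists i, (i \in (A :|: B)%SET) && (x i != v)].
      right; have := sum_powR_tangent_lt p1 (ltW v0) x0' iU xi.
      by rewrite eU xU.
    have xv' i : i \in (A :|: B)%SET -> x i = v.
      by move=> iU; apply/eqP; have := xv i; rewrite iU negbK.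
    have sAE : sA = (alpha + 1) * v.
      rewrite -cA mulr_natl -sumr_const; apply: eq_bigr => i iA.
      by apply: xv'; rewrite inE iA.
    have sBE : sB = (beta - 1) * v.
      rewrite -cB mulr_natl -sumr_const; apply: eq_bigr => i iB.
      by apply: xv'; rewrite inE iB orbT.
    left; rewrite sAE sBE -subr_gt0.
    have -> : alpha * v * (beta * v) - (alpha + 1) * v * ((beta - 1) * v) =
      (alpha - beta + 1) * (v * v) by ring.
    by apply: mulr_gt0; [lra|exact: mulr_gt0].
(* In the other case the totals [M] and [m] are kept and levelled inside the new blocks. Then
   [v < w], and the tangents at [v] on [A] and at [w] on [B] show that the norm drops by at least
   [(p - 1) * (w ^ p - v ^ p)]. *)
have a0 : 0 < alpha by lra.
have b0 : 0 < beta by lra.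
pose v := M / alpha; pose w := m / beta.
have vM : alpha * v = M by rewrite /v; field; rewrite gt_eqF.
have wm : beta * w = m by rewrite /w; field; rewrite gt_eqF.
have M0 : 0 < M by rewrite lt_max sA0.
have v0 : 0 < v by exact: divr_gt0.
have MN : M * N < S * alpha by rewrite -ltr_pdivlMr.
have vw : v < w.
  rewrite /v /w ltr_pdivrMr// mulrAC ltr_pdivlMr//.
  by move: MN; rewrite -Mm /N; nra.
have w0 : 0 < w by lra.
have pw : v `^ p < w `^ p by apply: gt0_ltr_powR; rewrite ?nnegrE// ltW.
have pw1 : v `^ (p - 1) < w `^ (p - 1).
  by apply: gt0_ltr_powR; rewrite ?nnegrE//; lra.
have powS u : 0 < u -> u * u `^ (p - 1) = u `^ p.
  move=> u0; rewrite mulrC -{2}(powRr1 (ltW u0)) -powRD ?subrK//.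
  by rewrite (gt_eqF u0) implybT.
have lt : alpha * v `^ p + beta * w `^ p <
      \sum_(i in A) x i `^ p + \sum_(i in B) x i `^ p.
  have tA := sum_powR_tangent A p1 (ltW v0) x0'.
  have tB := sum_powR_tangent B p1 (ltW w0) x0'.
  apply: lt_le_trans (lerD tA tB); rewrite cA cB -/sA -/sB.
  (* Rearrangement: pairing the larger slope with the smaller total gives the least value. *)
  have rearr : v `^ (p - 1) * M + w `^ (p - 1) * m <= v `^ (p - 1) * sA + w `^ (p - 1) * sB.
    by rewrite /M /m; case: (leP sA sB) => h; nra.
  have : 0 < (p - 1) * (w `^ p - v `^ p) by apply: mulr_gt0; lra.
  have := ler_wpM2l (ltW p0) rearr.
  rewrite -vM -wm -(powS v v0) -(powS w w0).
  move: (v `^ (p - 1)) (w `^ (p - 1)) => V W; lra.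
exists v, w; split=> //.
- by rewrite vM wm Mm.
- by rewrite vM wm MmM.
- exact: ltW.
- by right.
Qed.

(** * Colourings and the polynomial form of a complete multipartite graph *)

(** The tuples of values of [f] and [g] contain each value equally often, hence one is a permutation
    of the other. *)
Lemma perm_of_eq_fibres (n : nat) (T : eqType) (f g : 'I_n -> T) :
  (forall y, #|[set i | f i == y]%SET| = #|[set i | g i == y]%SET|) ->
  exists s : {perm 'I_n}, forall i, f i = g (s i).
Proof.
move=> fg.
have cnt (h : 'I_n -> T) y : count_mem y [tuple h i | i < n] = #|[set i | h i == y]%SET|.
  rewrite /= count_map -sum1_count -sum1_card big_enum_cond /=.
  by apply: eq_bigl => i; rewrite !inE.
have /tuple_permP[s sE] : perm_eq [tuple f i | i < n] [tuple g i | i < n].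
  apply/allP => y _; rewrite /= !cnt fg; exact: eqxx.
exists s => i; have /val_inj := sE => E.
by have := congr1 (fun t => tnth t i) E; rewrite !tnth_mktuple.
Qed.

(** A partition is encoded by its colouring [c]: moving a vertex changes one value, and the
    colourings form a finite type over which to maximize. *)
Definition fibre (n k : nat) (c : 'I_n -> 'I_k) (j : 'I_k) : {set 'I_n} :=
  [set i | c i == j]%SET.

Definition multipartite (k r n : nat) (c : 'I_n -> 'I_k) : uhypergraph r n :=
  complete_kpartite r (fibre c).

Definition colour_sum {R : realType} (n k : nat) (c : 'I_n -> 'I_k) (x : 'rV[R]_n)
  (j : 'I_k) : R := \sum_(i in fibre c j) x ord0 i.

(** Both sides say that [c] is injective on [e]. *)
Lemma crosses_fibre (n k : nat) (c : 'I_n -> 'I_k) (e : {set 'I_n}) :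
  crosses (fibre c) e = (#|[set c i | i in e]%SET| == #|e|).
Proof.
apply/forallP/imset_injP => [ce i i' ie i'e cii'|ce j].
  have /card_le1P/(_ i) := ce (c i); rewrite !inE ie eqxx => /(_ isT).
  by move=> /(_ i'); rewrite !inE i'e -cii' eqxx => /esym/eqP.
apply/card_le1_eqP => i i'; rewrite !inE => /andP[ie /eqP ci] /andP[i'e /eqP ci'].
by apply: ce => //; rewrite ci.
Qed.

(** Expanding the product of sums gives one term for each section of [c] over [J]. A section is
    determined by its image, which can be any set that [c] maps bijectively onto [J]. Sections take
    the default value [i0] outside [J]. *)
Lemma sum_transversals {R : realType} (n k : nat) (c : 'I_n -> 'I_k) (i0 : 'I_n)
    (J : {set 'I_k}) (x : 'I_n -> R) :
  \sum_(e : {set 'I_n} | (#|e| == #|J|) && ([set c i | i in e]%SET == J))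
    \prod_(i in e) x i = \prod_(j in J) \sum_(i | c i == j) x i.
Proof.
rewrite (big_distr_big_dep i0).
(* The inverse bijection: [sec e] sends a colour in [J] to the vertex of [e] that has it. *)
pose sec (e : {set 'I_n}) := [ffun j : 'I_k =>
  if j \in J then odflt i0 [pick i in e | c i == j] else i0].
rewrite (reindex_onto (fun f : {ffun 'I_k -> 'I_n} => [set f j | j in J]%SET) sec) /=.
  have fP (f : {ffun 'I_k -> 'I_n}) : (f \in pfamily i0 (mem J) (fun j i => c i == j)) =
     [&& #|[set f j | j in J]%SET| == #|J|, [set c i | i in [set f j | j in J]]%SET == J
      & sec [set f j | j in J]%SET == f].
    apply/idP/idP => [/pfamilyP[sf cf]|/and3P[fJ cfJ /eqP sf]].
      have cf' j : j \in J -> c (f j) = j by move=> /cf /eqP.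
      apply/and3P; split.
      - by apply/imset_injP => j j' jJ j'J jj'; rewrite -(cf' j)// jj' cf'.
      - apply/eqP/setP => j; apply/imsetP/idP => [[_ /imsetP[j' j'J ->] ->]|jJ].
          by rewrite cf'.
        by exists (f j); rewrite ?cf'// imset_f.
      - apply/eqP/ffunP => j; rewrite ffunE; case: ifPn => jJ.
          case: pickP => [i /= /andP[/imsetP[j' j'J ->]]|/(_ (f j))].
            by rewrite cf'// => /eqP ->.
          by rewrite cf' ?eqxx ?imset_f.
        apply/esym/eqP; apply: contraNT jJ => fj.
        by apply: (fintype.subsetP sf); rewrite inE.
    apply/pfamilyP; split.
      apply/fintype.subsetP => j; rewrite inE -sf ffunE; case: ifP => //.
      by rewrite eqxx.
    move=> j jJ; rewrite -sf ffunE jJ; case: pickP => [i /andP[_ //]|/= no].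
    move: jJ; rewrite -{1}(eqP cfJ) => /imsetP[i ie ji].
    by have := no i; rewrite ie -ji eqxx.
  apply: eq_big => [f|f].
    by rewrite fP andbA.
  rewrite -andbA => /and3P[/imset_injP fJ _ _].
  by rewrite big_imset.
move=> e /andP[/eqP eJ /eqP ceJ].
have inj : {in e &, injective c} by apply/imset_injP; rewrite ceJ eJ.
have secE i : i \in e -> sec e (c i) = i.
  move=> ie; rewrite ffunE -ceJ imset_f//; case: pickP => [i' /= /andP[i'e /eqP]|].
    by move=> /inj ->.
  by move=> /(_ i); rewrite ie eqxx.
apply/setP => i; apply/imsetP/idP => [[j]|ie].
  by rewrite -ceJ => /imsetP[i' i'e ->] ->; rewrite secE.
by exists (c i); rewrite ?secE// -ceJ imset_f.
Qed.

(** Edges are grouped by their set [J] of colours; those with colours [J] are the transversals over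
    [J]. The hypothesis [0 < n] supplies the default vertex. *)
Lemma polyform_multipartite {R : realType} (k r n : nat) (c : 'I_n -> 'I_k)
    (x : 'rV[R]_n) : (0 < n)%N ->
  polyform (multipartite r c) x = (r`!)%:R * elem_sym r [set: 'I_k] (colour_sum c x).
Proof.
move=> n0; congr (_ * _).
rewrite (partition_big (fun e : {set 'I_n} => [set c i | i in e]%SET)
  (fun J : {set 'I_k} => (J \subset [set: 'I_k]%SET) && (#|J| == r))) /=.
  apply: eq_bigr => J /andP[_ /eqP <-].
  under [RHS]eq_bigr => j _ do
    (rewrite /colour_sum; under eq_bigl => i do rewrite inE).
  rewrite -(sum_transversals c (Ordinal n0)).
  apply: eq_bigl => e; rewrite inE crosses_fibre -andbA; apply: andb_id2l => /eqP eJ.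
  by apply/andP/idP => [[]//|/eqP ceJ]; rewrite ceJ eJ !eqxx.
move=> e; rewrite inE crosses_fibre => /andP[/eqP er /eqP ->].
by rewrite er eqxx finset.subsetT.
Qed.

(** * Positivity of elementary symmetric polynomials *)

Section ElementarySymmetricOrder.
Context {R : realType} {I : finType}.
Implicit Types (m : nat) (D : {set I}) (s : I -> R).

Lemma elem_sym_ge0 m D s : (forall j, 0 <= s j) -> 0 <= elem_sym m D s.
Proof. by move=> s0; apply: sumr_ge0 => J _; exact: prodr_ge0. Qed.

Lemma elem_sym_gt0 m D s (J : {set I}) : (forall j, 0 <= s j) ->
  J \subset D -> #|J| = m -> {in J, forall j, 0 < s j} -> 0 < elem_sym m D s.
Proof.
move=> s0 JD Jm sJ; rewrite /elem_sym (bigD1 J) /=; last by rewrite JD Jm eqxx.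
apply: ltr_wpDr; last exact: prodr_gt0.
by apply: sumr_ge0 => J' _; exact: prodr_ge0.
Qed.

Lemma elem_sym_gt0_ex m D s : (forall j, 0 <= s j) -> 0 < elem_sym m D s ->
  exists J : {set I}, [/\ J \subset D, #|J| = m & {in J, forall j, 0 < s j}].
Proof.
move=> s0 sD.
have [/existsP[J /and3P[JD /eqP Jm /forallP sJ]]|/existsPn no] :=
    boolP [exists J : {set I}, [&& J \subset D, #|J| == m &
      [forall j, (j \in J) ==> (0 < s j)]]].
  by exists J; split=> // j jJ; apply: (implyP (sJ j)).
move: sD; rewrite /elem_sym big1 ?ltxx// => J /andP[JD Jm].
have := no J; rewrite JD Jm /= => /forallPn[j]; rewrite negb_imply => /andP[jJ sj].
rewrite (bigD1 j)//=; have -> : s j = 0 by apply/eqP; rewrite eq_le s0 leNgt sj.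
by rewrite mul0r.
Qed.

(** Some [m + 2] indices have positive values, and deleting [a] and [b] leaves at least [m] of them.
    The lemma makes the coefficient of [s a * s b] positive. *)
Lemma elem_sym_minor_gt0 m s a b : (forall j, 0 <= s j) ->
  0 < elem_sym m.+2 [set: I] s -> 0 < elem_sym m (~: [set a; b])%SET s.
Proof.
move=> s0 /(elem_sym_gt0_ex s0)[J [_ Jm sJ]].
have : (m <= #|J :\: [set a; b]|)%N.
  have := cardsD J [set a; b]%SET; have := subset_leq_card (finset.subsetIr J [set a; b]%SET).
  by rewrite cards2; case: (a != b); lia.
move=> /card_geqP[l [ul lm lJ]].
apply: (@elem_sym_gt0 _ _ _ [set j in l]%SET) => //.
- by apply/fintype.subsetP => j; rewrite inE => /lJ; rewrite !inE => /andP[].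
- by rewrite cardsE -lm; apply/card_uniqP.
- by move=> j; rewrite inE => /lJ; rewrite inE => /andP[_]; exact: sJ.
Qed.

End ElementarySymmetricOrder.

(** * Homogeneity and the spectral radius *)

(** The [p]-th power of the usual norm, without the root; [psphere] is its level set at 1. *)
Definition pnorm {R : realType} (n : nat) (p : R) (x : 'rV[R]_n) : R :=
  \sum_(i < n) `|x ord0 i| `^ p.

Lemma pnorm_scale {R : realType} (n : nat) (p a : R) (x : 'rV[R]_n) :
  pnorm p (a *: x) = `|a| `^ p * pnorm p x.
Proof.
rewrite /pnorm mulr_sumr; apply: eq_bigr => i _.
by rewrite mxE normrM powRM.
Qed.

Lemma polyform_scale {R : realType} (r n : nat) (G : uhypergraph r n) (a : R)
  (x : 'rV[R]_n) : polyform G (a *: x) = a ^+ r * polyform G x.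
Proof.
rewrite /polyform mulrCA; congr (_ * _); rewrite mulr_sumr; apply: eq_bigr => e eG.
under eq_bigr do rewrite mxE.
by rewrite big_split /= prodr_const (edges_uniform eG).
Qed.

Lemma polyform_gt0_pnorm {R : realType} (r n : nat) (G : uhypergraph r n) (p : R)
  (x : 'rV[R]_n) : (0 < r)%N -> 0 < polyform G x -> 0 < pnorm p x.
Proof.
move=> r0 Gx; rewrite lt0r sumr_ge0 ?andbT; last by move=> i _; exact: powR_ge0.
apply: contraTN Gx => /eqP/psumr_eq0P x0; rewrite -leNgt.
rewrite /polyform big1 ?mulr0// => e eG.
have /card_gt0P[i ie] : (0 < #|e|)%N by rewrite (edges_uniform eG).
rewrite (bigD1 i)//=.
have /eqP : `|x ord0 i| `^ p = 0 by apply: x0 => // j _; exact: powR_ge0.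
by rewrite powR_eq0 normr_eq0 => /andP[/eqP -> _]; rewrite mul0r.
Qed.

Section Radius.
Context {R : realType} (r n : nat) (G : uhypergraph r n) (p : R).
Context (r0 : (0 < r)%N) (n0 : (0 < n)%N) (p1 : 1 < p).

Lemma polyform_le_radius (y : 'rV[R]_n) : pnorm p y = 1 ->
  polyform G y <= pspectral_radius p G.
Proof.
move=> yS; have [x xS [-> xmax]] := pspectral_radius_max G n0 (ltW p1).
exact: xmax.
Qed.

(** Replacing the entries of a maximizer by their absolute values keeps the norm and does not
    decrease the form, whose coefficients are nonnegative. *)
Lemma nonneg_maximizer : exists x : 'rV[R]_n,
  [/\ forall i, 0 <= x ord0 i, pnorm p x = 1 &
      polyform G x = pspectral_radius p G].
Proof.
have [x xS [Gx xmax]] := pspectral_radius_max G n0 (ltW p1).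
pose y := \row_i `|x ord0 i| : 'rV[R]_n.
have yS : pnorm p y = 1.
  by rewrite -[RHS]xS; apply: eq_bigr => i _; rewrite mxE normr_id.
exists y; split=> [i|//|]; first by rewrite mxE.
apply/eqP; rewrite eq_le polyform_le_radius//= Gx.
rewrite ler_wpM2l//; apply: ler_sum => e _.
apply: le_trans (ler_norm _) _; rewrite normr_prod.
by under [leRHS]eq_bigr do rewrite mxE.
Qed.

(** The factor [a], which is [pnorm p y] to the power [-1/p], brings [y] onto the sphere, and the
    form is homogeneous of degree [r]. A norm below 1 thus becomes a gain in the form. *)
Lemma polyform_rescale (y : 'rV[R]_n) : 0 < polyform G y -> exists a : R,
  [/\ 0 < a, a ^+ r * polyform G y <= pspectral_radius p G,
      pnorm p y <= 1 -> 1 <= a & pnorm p y < 1 -> 1 < a].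
Proof.
move=> Gy; have Ny := polyform_gt0_pnorm p r0 Gy.
have p0 : 0 < p by exact: lt_trans ltr01 p1.
pose a := (pnorm p y)^-1 `^ p^-1.
have a0 : 0 < a by rewrite powR_gt0// invr_gt0.
have ap : a `^ p = (pnorm p y)^-1.
  by rewrite -powRrM mulVf ?gt_eqF// powRr1// invr_ge0 ltW.
exists a; split=> //.
- rewrite -polyform_scale polyform_le_radius// pnorm_scale gtr0_norm// ap mulVf//.
  by rewrite gt_eqF.
- move=> N1; rewrite leNgt; apply/negP => a1.
  have : a `^ p < 1 `^ p by apply: gt0_ltr_powR; rewrite ?nnegrE// ltW.
  by rewrite powR1 ap invf_lt1// ltNge N1.
- move=> N1; rewrite ltNge; apply/negP => a1.
  have : a `^ p <= 1 `^ p by apply: ge0_ler_powR; rewrite ?nnegrE// ltW.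
  by rewrite powR1 ap invf_le1// leNgt N1.
Qed.

Lemma polyform_le_radius_sub (y : 'rV[R]_n) : 0 < polyform G y ->
  pnorm p y <= 1 -> polyform G y <= pspectral_radius p G.
Proof.
move=> Gy N1; have [a [a0 aG /(_ N1) a1 _]] := polyform_rescale Gy.
by apply: le_trans aG; rewrite ler_peMl ?exprn_ege1// ltW.
Qed.

Lemma polyform_lt_radius_sub (y : 'rV[R]_n) : 0 < polyform G y ->
  pnorm p y < 1 -> polyform G y < pspectral_radius p G.
Proof.
move=> Gy N1; have [a [a0 aG _ /(_ N1) a1]] := polyform_rescale Gy.
by apply: lt_le_trans aG; rewrite ltr_pMl ?exprn_egt1// -lt0n.
Qed.

Lemma radius_gt0 (y : 'rV[R]_n) : 0 < polyform G y -> 0 < pspectral_radius p G.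
Proof.
move=> Gy; have [a [a0 aG _ _]] := polyform_rescale Gy.
by apply: lt_le_trans aG; rewrite mulr_gt0// exprn_gt0.
Qed.

End Radius.

(** * Maximizers of complete multipartite graphs are positive *)

Lemma colour_sum_ge0 {R : realType} (n k : nat) (c : 'I_n -> 'I_k) (x : 'rV[R]_n) :
  (forall i, 0 <= x ord0 i) -> forall j, 0 <= colour_sum c x j.
Proof. by move=> x0 j; exact: sumr_ge0. Qed.

Lemma colour_sum_ge {R : realType} (n k : nat) (c : 'I_n -> 'I_k) (x : 'rV[R]_n) i :
  (forall i, 0 <= x ord0 i) -> x ord0 i <= colour_sum c x (c i).
Proof.
move=> x0; rewrite /colour_sum (bigD1 i) ?inE//= lerDl.
exact: sumr_ge0.
Qed.

Lemma sum_indicator {R : realType} (n : nat) (A : {set 'I_n}) (v : 'I_n) (h : R) :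
  \sum_(i in A) h * (i == v)%:R = h * (v \in A)%:R.
Proof.
rewrite -mulr_sumr; congr (_ * _); have [vA|vA] := boolP (v \in A).
  by rewrite (bigD1 v)//= eqxx big1 ?addr0// => i /andP[_ /negbTE ->].
by rewrite big1// => i iA; case: eqP => // iv; rewrite -iv iA in vA.
Qed.

(* A vertex of weight 0 could take half the weight of a suitable other vertex:
   this does not decrease the form, and strictly decreases the norm. *)
Lemma multipartite_maximizer_gt0 {R : realType} (k m n : nat) (c : 'I_n -> 'I_k)
    (p : R) (x : 'rV[R]_n) (G := multipartite m.+2 c) : (0 < n)%N -> 1 < p ->
  (forall i, 0 <= x ord0 i) -> pnorm p x = 1 -> polyform G x = pspectral_radius p G ->
  0 < pspectral_radius p G -> forall v, 0 < x ord0 v.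
Proof.
move=> n0 p1 x0 xS Gx lam0 v; rewrite lt0r x0 andbT; apply/negP => /eqP xv.
set s := colour_sum c x.
have s0 : forall j, 0 <= s j by exact: colour_sum_ge0.
(* The donor [w] is taken in the class of [v] if that class has positive total; otherwise any vertex
   of positive weight serves. *)
have [w xw sw] : exists2 w, 0 < x ord0 w & c v = c w \/ s (c v) = 0.
  have [sv|sv] := eqVneq (s (c v)) 0.
    have [/existsP[w xw]|/existsPn no] := boolP [exists w, 0 < x ord0 w].
      by exists w => //; right.
    move: xS; rewrite /pnorm big1 => [/esym/eqP|i _]; first by rewrite oner_eq0.
    have -> : x ord0 i = 0 by apply/eqP; rewrite eq_le x0 andbT leNgt no.
    by rewrite normr0 powR0// gt_eqF//; lra.
  have [/existsP[w /andP[/eqP cw xw]]|/existsPn no] :=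
    boolP [exists w, (c w == c v) && (0 < x ord0 w)].
    by exists w => //; left.
  move: sv; rewrite /s /colour_sum big1 ?eqxx// => i; rewrite inE => ci.
  by have := no i; rewrite ci /= => xi; apply/eqP; rewrite eq_le x0 andbT leNgt.
have wv : w != v by apply: contraTneq xw => ->; rewrite xv ltxx.
pose h := x ord0 w / 2.
have h0 : 0 < h by rewrite /h; lra.
pose y : 'rV[R]_n := \row_i (x ord0 i + h * (i == v)%:R - h * (i == w)%:R).
have yv : y ord0 v = h by rewrite mxE xv eqxx eq_sym (negbTE wv) /=; ring.
have yw : y ord0 w = h by rewrite mxE eqxx (negbTE wv) /h /=; field.
have yx i : i != v -> i != w -> y ord0 i = x ord0 i.
  by move=> iv iw; rewrite mxE (negbTE iv) (negbTE iw) /=; ring.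
have yS : pnorm p y < 1.
  rewrite -xS /pnorm (bigD1 v)//= (bigD1 w)//= [ltRHS](bigD1 v)//= [X in _ < _ + X](bigD1 w)//=.
  rewrite !addrA; apply: ltr_leD; last first.
    by apply: ler_sum => i /andP[iv iw]; rewrite yx.
  rewrite yv yw !ger0_norm// ?ltW//.
  have xwh : x ord0 w != h by rewrite gt_eqF// /h; lra.
  have xvh : x ord0 v != h by rewrite xv lt_eqF.
  (* The old weights 0 and [2h] are symmetric about [h], so the slope terms of the two tangents at
     [h] cancel. *)
  have := tangent_powR_lt p1 (x0 w) (ltW h0) xwh.
  have := tangent_powR_lt p1 (x0 v) (ltW h0) xvh.
  have -> : x ord0 w - h = h by rewrite /h; field.
  rewrite xv; lra.
set t := colour_sum c y.
have tE j : t j = s j + h * (c v == j)%:R - h * (c w == j)%:R.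
  rewrite /t /s /colour_sum; under eq_bigr do rewrite mxE.
  by rewrite sumrB big_split /= !sum_indicator !inE.
have Gxy : polyform G x <= polyform G y.
  rewrite /G !polyform_multipartite// -/s -/t ler_wpM2l//.
  (* Within one class no colour sum changes. Across two classes the sum of their totals is kept,
     while the product goes from 0 to [h * (s (c w) - h)], which is nonnegative. *)
  have [cvw|cvw] := eqVneq (c v) (c w).
    rewrite (@eq_elem_sym _ _ _ _ s t)// => j _; rewrite tE cvw; ring.
  have sv : s (c v) = 0 by case: sw => // E; rewrite E eqxx in cvw.
  rewrite !(elem_sym_split2 _ _ cvw) /=.
  have st : {in (~: [set c v; c w])%SET, s =1 t}.
    move=> j; rewrite !inE negb_or => /andP[jv jw].
    by rewrite tE eq_sym (negbTE jv) eq_sym (negbTE jw) /=; ring.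
  rewrite !(eq_elem_sym _ st) !tE !eqxx (negbTE cvw) eq_sym (negbTE cvw) sv /=.
  have hs : h <= s (c w) by apply: le_trans (colour_sum_ge c w x0); rewrite /h; lra.
  rewrite -subr_ge0.
  set E1 := elem_sym m.+1 _ _; set E2 := elem_sym m.+2 _ _; set E0 := elem_sym m _ _.
  have E00 : 0 <= E0.
    by rewrite /E0 -(eq_elem_sym _ st); exact: elem_sym_ge0.
  rewrite [leRHS](_ : _ = h * (s (c w) - h) * E0); last by ring.
  by rewrite !mulr_ge0 ?subr_ge0// ltW.
have Gy : 0 < polyform G y by apply: lt_le_trans Gxy; rewrite Gx.
have := polyform_lt_radius_sub (isT : (0 < m.+2)%N) n0 p1 Gy yS.
by rewrite -Gx ltNge Gxy.
Qed.

(** * Moving a vertex between unbalanced classes *)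

Lemma sum_two_fibres {R : realType} (n k : nat) (c : 'I_n -> 'I_k) (a b : 'I_k)
    (F : 'I_n -> R) : a != b ->
  \sum_i F i = \sum_(i in fibre c a) F i + \sum_(i in fibre c b) F i +
    \sum_(i | (c i != a) && (c i != b)) F i.
Proof.
move=> ab; rewrite (bigID (fun i => c i == a)) /= -addrA; congr (_ + _).
  by apply: eq_bigl => i; rewrite inE.
rewrite (bigID (fun i => c i == b)) /=; congr (_ + _).
apply: eq_bigl => i; rewrite inE; have [->|] := eqVneq (c i) b; last by rewrite andbF.
by rewrite eq_sym ab.
Qed.

Lemma unbalanced_not_maximal {R : realType} (k m n : nat) (c : 'I_n -> 'I_k) (p : R)
    (a b : 'I_k) : (0 < n)%N -> 1 < p ->
  0 < pspectral_radius p (multipartite m.+2 c) -> (#|fibre c b|.+1 < #|fibre c a|)%N ->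
  exists c' : 'I_n -> 'I_k,
    pspectral_radius p (multipartite m.+2 c) < pspectral_radius p (multipartite m.+2 c').
Proof.
move=> n0 p1 lam0 ba.
have [x [x0 xS Gx]] := nonneg_maximizer (multipartite m.+2 c) n0 p1.
have xpos := multipartite_maximizer_gt0 n0 p1 x0 xS Gx lam0.
have ab : a != b by apply: contraTneq ba => ->; rewrite -leqNgt.
have dab : [disjoint fibre c a & fibre c b].
  apply/pred0P => i; rewrite /= !inE; apply/negP => /andP[/eqP ->].
  by rewrite (negbTE ab).
have [v [w [[v0 w0] Sab prod_le norm_le strict]]] := rebalance_blocks p1 xpos dab ba.
have /card_gt0P[u] : (0 < #|fibre c a|)%N by lia.
rewrite inE => /eqP cu.
(* The vertex [u] moves from class [a] to class [b], and [y] puts the levelled weights [v] and [w]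
   on the two new classes. *)
pose c' i := if i == u then b else c i.
pose y : 'rV[R]_n := \row_i (if c' i == a then v else if c' i == b then w else x ord0 i).
have ba' : (b == a) = false by rewrite eq_sym (negbTE ab).
have fa : fibre c' a = (fibre c a :\ u)%SET.
  apply/setP => i; rewrite !inE /c'; case: (eqVneq i u) => //= _.
have fb : fibre c' b = (u |: fibre c b)%SET.
  by apply/setP => i; rewrite !inE /c'; case: (eqVneq i u) => //= _; rewrite eqxx.
have ca : #|fibre c' a| = #|fibre c a|.-1.
  by rewrite fa (cardsD1 u (fibre c a)) inE cu eqxx.
have cb : #|fibre c' b| = #|fibre c b|.+1.
  by rewrite fb cardsU1 inE cu (negbTE ab).
have ya i : i \in fibre c' a -> y ord0 i = v by rewrite inE mxE => ->.
have yb i : i \in fibre c' b -> y ord0 i = w.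
  by rewrite inE mxE => /eqP ->; rewrite ba' eqxx.
have c'E i : (c' i != a) && (c' i != b) = (c i != a) && (c i != b).
  by rewrite /c'; case: (eqVneq i u) => [->|//]; rewrite cu !eqxx andbF.
have yr i : (c i != a) && (c i != b) -> y ord0 i = x ord0 i.
  by rewrite -c'E mxE => /andP[/negbTE -> /negbTE ->].
have y0 i : 0 <= y ord0 i by rewrite mxE; do 2?case: ifP => _ //; rewrite ltW.
set s := colour_sum c x in Sab prod_le strict *; set t := colour_sum c' y.
have s0 : forall j, 0 <= s j by exact: colour_sum_ge0.
have ta : t a = (#|fibre c a|.-1)%:R * v.
  by rewrite -ca mulr_natl -sumr_const; apply: eq_bigr => i /ya.
have tb : t b = (#|fibre c b|.+1)%:R * w.
  by rewrite -cb mulr_natl -sumr_const; apply: eq_bigr => i /yb.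
have st : {in (~: [set a; b])%SET, s =1 t}.
  move=> j; rewrite !inE negb_or => /andP[ja jb]; rewrite /s /t /colour_sum.
  have -> : fibre c' j = fibre c j.
    apply/setP => i; rewrite !inE /c'; case: (eqVneq i u) => [->|//].
    by rewrite cu eq_sym (negbTE jb) eq_sym (negbTE ja).
  by apply: eq_bigr => i; rewrite inE => /eqP ci; rewrite yr// ci ja jb.
have normE : 1 - pnorm p y =
    \sum_(i in fibre c a) x ord0 i `^ p + \sum_(i in fibre c b) x ord0 i `^ p -
    ((#|fibre c a|.-1)%:R * v `^ p + (#|fibre c b|.+1)%:R * w `^ p).
  have absE (z : 'rV[R]_n) : (forall i, 0 <= z ord0 i) ->
      pnorm p z = \sum_i z ord0 i `^ p.
    by move=> z0; apply: eq_bigr => i _; rewrite ger0_norm.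
  rewrite -[X in X - pnorm p y]xS !absE// (sum_two_fibres c _ ab) (sum_two_fibres c' _ ab).
  under [X in _ - (X + _ + _)]eq_bigr => i ia do rewrite ya//.
  under [X in _ - (_ + X + _)]eq_bigr => i ia do rewrite yb//.
  rewrite !sumr_const ca cb !mulr_natl (eq_bigl _ _ c'E).
  under [X in _ - (_ + _ + X)]eq_bigr => i ia do rewrite yr//.
  ring.
set G := multipartite m.+2 c in lam0 Gx *; pose G' := multipartite m.+2 c'.
(* The other colour sums and [s a + s b] are unchanged, so the form changes only through the product
   of the two totals, with coefficient [C]. *)
pose C := elem_sym m (~: [set a; b])%SET s.
have PE : polyform G' y - polyform G x = (m.+2`!)%:R * (C * (t a * t b - s a * s b)).
  rewrite /G /G' !polyform_multipartite// -/s -/t !(elem_sym_split2 _ _ ab) /=.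
  have -> : t a + t b = s a + s b by rewrite ta tb Sab.
  rewrite -!(eq_elem_sym _ st) -/C; ring.
have f0 : 0 < (m.+2`!)%:R :> R by rewrite ltr0n fact_gt0.
have C0 : 0 < C.
  apply: elem_sym_minor_gt0 => //.
  by move: lam0; rewrite -Gx /G polyform_multipartite// pmulr_rgt0.
exists c'; rewrite -/G'.
have Gxy : polyform G x <= polyform G' y.
  by rewrite -subr_ge0 PE !mulr_ge0 ?(ltW f0) ?(ltW C0)// subr_ge0 ta tb.
have Gy : 0 < polyform G' y by apply: lt_le_trans Gxy; rewrite Gx.
(* A larger product raises the form because [C] is positive; a smaller norm raises the radius by
   rescaling [y]. *)
rewrite -Gx; case: strict => [lt|lt].
  apply: (@lt_le_trans _ _ (polyform G' y)).
    by rewrite -subr_gt0 PE !mulr_gt0// subr_gt0 ta tb.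
  by apply: polyform_le_radius_sub => //; rewrite -subr_ge0 normE subr_ge0.
apply: le_lt_trans Gxy _; apply: polyform_lt_radius_sub => //.
by rewrite -subr_gt0 normE subr_gt0.
Qed.

(** * Monotonicity of the radius under adding edges *)

Lemma subgraph_polyform {R : realType} (r n : nat) (G H : uhypergraph r n)
    (x : 'rV[R]_n) : edges G \subset edges H ->
  polyform H x = polyform G x +
    (r`!)%:R * \sum_(e in edges H | e \notin edges G) \prod_(i in e) x ord0 i.
Proof.
move=> /fintype.subsetP GH; rewrite /polyform -mulrDr; congr (_ * _).
rewrite (bigID (fun e => e \in edges G)) /=; congr (_ + _).
by apply: eq_bigl => e; rewrite andb_idl//; exact: GH.
Qed.

Lemma subgraph_polyform_le {R : realType} (r n : nat) (G H : uhypergraph r n)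
    (x : 'rV[R]_n) : edges G \subset edges H -> (forall i, 0 <= x ord0 i) ->
  polyform G x <= polyform H x.
Proof.
move=> GH x0; rewrite (subgraph_polyform x GH) lerDl mulr_ge0// sumr_ge0// => e _.
exact: prodr_ge0.
Qed.

Lemma subgraph_radius_le {R : realType} (r n : nat) (G H : uhypergraph r n) (p : R) :
  (0 < n)%N -> 1 < p -> edges G \subset edges H ->
  pspectral_radius p G <= pspectral_radius p H.
Proof.
move=> n0 p1 GH; have [x [x0 xS <-]] := nonneg_maximizer G n0 p1.
exact: le_trans (subgraph_polyform_le GH x0) (polyform_le_radius H n0 p1 xS).
Qed.

(** If the radii were equal, a nonnegative maximizer of [G] would also maximize [K] and hence be
    positive; the term of an edge missing from [G] would then make the form of [K] exceed its
    maximum. *)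
Lemma proper_subgraph_radius_lt {R : realType} (k m n : nat) (c : 'I_n -> 'I_k)
    (G : uhypergraph m.+2 n) (p : R) (K := multipartite m.+2 c) : (0 < n)%N -> 1 < p ->
  edges G \proper edges K -> 0 < pspectral_radius p K ->
  pspectral_radius p G < pspectral_radius p K.
Proof.
move=> n0 p1 /properP[GK [e0 e0K e0G]] lam0.
have [x [x0 xS <-]] := nonneg_maximizer G n0 p1.
have Kx : polyform K x <= pspectral_radius p K by exact: polyform_le_radius.
have GKx := subgraph_polyform_le GK x0.
rewrite lt_neqAle (le_trans GKx Kx) andbT; apply/eqP => E.
have KE : polyform K x = pspectral_radius p K.
  by apply/eqP; rewrite eq_le Kx -E GKx.
have xpos := multipartite_maximizer_gt0 n0 p1 x0 xS KE lam0.
have : polyform G x < polyform K x.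
  rewrite (subgraph_polyform x GK) ltrDl mulr_gt0 ?ltr0n ?fact_gt0//.
  rewrite (bigD1 e0) /=; last by rewrite e0K e0G.
  apply: ltr_wpDr; last exact: prodr_gt0.
  by apply: sumr_ge0 => e _; exact: prodr_ge0.
by rewrite E KE ltxx.
Qed.

(** * Balanced colourings and isomorphism *)

Definition balanced (n k : nat) (c : 'I_n -> 'I_k) : Prop :=
  forall a b, (#|fibre c a| <= #|fibre c b|.+1)%N.

Lemma sum_card_fibre (n k : nat) (c : 'I_n -> 'I_k) : (\sum_j #|fibre c j|)%N = n.
Proof.
transitivity (\sum_(i < n) 1)%N; last by rewrite sum1_card card_ord.
rewrite (partition_big c xpredT)//=; apply: eq_bigr => j _.
by rewrite -sum1_card; apply: eq_bigl => i; rewrite inE.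
Qed.

(** Each class exceeds a smallest class [j0] by at most 1. The excesses add up to less than [k],
    because that of [j0] is 0, so the smallest size is the quotient [n %/ k]. *)
Lemma card_balanced_fibre (n k : nat) (c : 'I_n -> 'I_k) (j : 'I_k) : balanced c ->
  #|fibre c j| = (n %/ k + (#|fibre c j| == (n %/ k).+1))%N.
Proof.
move=> bal; have [j0 _ minj] := @arg_minnP _ j xpredT (fun j => #|fibre c j|) isT.
have jE i : #|fibre c i| = (#|fibre c j0| + (#|fibre c i| != #|fibre c j0|))%N.
  by have := minj i isT; have := bal i j0; case: eqP; lia.
have k0 : (0 < k)%N by exact: leq_ltn_trans (ltn_ord j).
suff qE : (n %/ k)%N = #|fibre c j0|.
  by rewrite qE; have := jE j; do 2!case: eqP; lia.
have nE : n = (#|fibre c j0| * k + \sum_i (#|fibre c i| != #|fibre c j0|))%N.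
  rewrite -{1}(sum_card_fibre c) (eq_bigr _ (fun i _ => jE i)) big_split /=.
  by rewrite sum_nat_const card_ord mulnC.
rewrite {1}nE divnMDl// divn_small ?addn0//.
rewrite (bigD1 j0)//= eqxx add0n.
apply: (@leq_ltn_trans (\sum_(i | i != j0) 1)%N); first by apply: leq_sum => i _; case: (_ != _).
by rewrite sum1_card cardC1 card_ord prednK.
Qed.

Lemma card_large_fibres (n k : nat) (c : 'I_n -> 'I_k) : balanced c ->
  #|[set j | #|fibre c j| == (n %/ k).+1]%SET| = (n %% k)%N.
Proof.
move=> bal; have := sum_card_fibre c.
rewrite (eq_bigr _ (fun j _ => card_balanced_fibre j bal)) big_split /=.
rewrite sum_nat_const card_ord => sumE.
have -> : #|[set j | #|fibre c j| == (n %/ k).+1]%SET| =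
    (\sum_j (#|fibre c j| == (n %/ k).+1))%N.
  by rewrite -sum1_card big_mkcond; apply: eq_bigr => j _; rewrite inE; case: eqP.
by apply: (@addnI (k * (n %/ k))%N); rewrite sumE mulnC -divn_eq.
Qed.

(** Balance and [n] fix how many classes have each size. A permutation [s] of the colours therefore
    matches class sizes, and then a permutation [t] of the vertices carries each class of [c] onto
    the matching class of [d]. *)
Lemma balanced_iso (k r n : nat) (c d : 'I_n -> 'I_k) : balanced c -> balanced d ->
  uhypergraph_iso (multipartite r c) (multipartite r d).
Proof.
move=> bc bd.
have [s sE] : exists s : {perm 'I_k}, forall j, #|fibre c j| = #|fibre d (s j)|.
  apply: (@perm_of_eq_fibres k _ (fun j => #|fibre c j|) (fun j => #|fibre d j|)) => q.
  have small (f : 'I_n -> 'I_k) : balanced f ->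
      #|[set j | #|fibre f j| == (n %/ k)%N]%SET| = (k - n %% k)%N.
    move=> bf; rewrite -(card_large_fibres bf) -[X in (X - _)%N]card_ord.
    rewrite -(cardsC [set j | #|fibre f j| == (n %/ k).+1]%SET) addKn.
    apply: eq_card => j; rewrite !inE; have := card_balanced_fibre j bf.
    by do 2!case: eqP; lia.
  have [->|q1] := eqVneq q (n %/ k).+1; first by rewrite !card_large_fibres.
  have [->|q0] := eqVneq q (n %/ k)%N; first by rewrite !small.
  have none (f : 'I_n -> 'I_k) : balanced f -> #|[set j | #|fibre f j| == q]%SET| = 0%N.
    move=> bf; apply: eq_card0 => j; rewrite !inE; apply/negP => /eqP jq.
    have := card_balanced_fibre j bf; rewrite jq (negbTE q1) addn0 => /eqP.
    by rewrite (negbTE q0).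
  by rewrite !none.
have [t tE] : exists t : {perm 'I_n}, forall i, s (c i) = d (t i).
  apply: (@perm_of_eq_fibres n _ (s \o c) d) => j.
  have := sE ((s^-1)%g j); rewrite permKV => <-; apply: eq_card => i; rewrite !inE /=.
  by rewrite -[RHS](inj_eq (@perm_inj _ s)) permKV.
exists t; apply/setP => e.
have crossE (e' : {set 'I_n}) : (e' \in edges (multipartite r c)) =
    ([set t i | i in e']%SET \in edges (multipartite r d)).
  rewrite !inE !crosses_fibre (card_imset _ (@perm_inj _ t)).
  have <- : (s @: (c @: e') = d @: (t @: e'))%SET.
    by rewrite -!imset_comp; apply: eq_imset => i /=.
  by rewrite (card_imset _ (@perm_inj _ s)).
apply/idP/imsetP => [ed|[e' e'c ->]]; last by rewrite -crossE.
have te : [set t i | i in [set (t^-1)%g i | i in e]]%SET = e.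
  rewrite -imset_comp -[RHS]imset_id; apply: eq_imset => i /=; exact: permKV.
by exists [set (t^-1)%g i | i in e]%SET; rewrite ?te// crossE te.
Qed.

Lemma iso_radius {R : realType} (r n : nat) (G H : uhypergraph r n) (p : R) :
  uhypergraph_iso G H -> pspectral_radius p G = pspectral_radius p H.
Proof.
move=> [s HE].
have polyE (x : 'rV[R]_n) : polyform H x = polyform G (\row_i x ord0 (s i)).
  rewrite /polyform HE big_imset /=; last by move=> e e' _ _; apply/imset_inj/perm_inj.
  congr (_ * _); apply: eq_bigr => e _; rewrite big_imset /=; last first.
    by move=> i i' _ _; exact: perm_inj.
  by apply: eq_bigr => i _; rewrite mxE.
have sphereE (t : {perm 'I_n}) (x : 'rV[R]_n) : psphere p x ->
    psphere p (\row_i x ord0 (t i)).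
  rewrite /psphere /= => <-; rewrite [RHS](reindex_inj (@perm_inj _ t)).
  by apply: eq_bigr => i _; rewrite mxE.
congr sup; apply/seteqP; split=> _ [x xS <-].
  exists (\row_i x ord0 ((s^-1)%g i)); first exact: sphereE.
  rewrite polyE; congr polyform; apply/rowP => i.
  by rewrite !mxE permK.
by exists (\row_i x ord0 (s i)); [exact: sphereE|rewrite polyE].
Qed.

Lemma kpartition_fibre (n k : nat) (V : 'I_k -> {set 'I_n}) : kpartition V ->
  exists c : 'I_n -> 'I_k, V = fibre c.
Proof.
move=> kV; have [c cV] := choice kV; exists c; apply/funext => j.
apply/setP => i; rewrite inE; have [ici uni] := cV i.
by apply/idP/eqP => [/uni//|<-].
Qed.

Lemma turan_part_balanced (k n : nat) (c : 'I_n -> 'I_k) :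
  @turan_part k n = fibre c -> balanced c.
Proof.
move=> tc a b; rewrite -tc.
have k0 : (0 < k)%N by exact: leq_ltn_trans (ltn_ord a).
have : ((n + k.-1) %/ k <= (n %/ k).+1)%N.
  have -> : (n %/ k).+1 = ((n + k) %/ k)%N by rewrite divnDr// divnn k0 addn1.
  by apply: leq_div2r; lia.
have : (n %/ k <= (n + k.-1) %/ k)%N by apply: leq_div2r; lia.
case: (card_turan_part n a) (card_turan_part n b) => -> [] ->; lia.
Qed.

(** * The Turan graph as the unique maximum *)

(** The first [r] vertices have distinct residues modulo [k] since [r <= k], so they form an edge,
    and the all-ones vector has positive form. *)
Lemma turan_radius_gt0 {R : realType} (k r n : nat) (p : R) :
  (0 < r)%N -> (r <= k)%N -> (r <= n)%N -> 1 < p ->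
  0 < pspectral_radius p (turan k r n).
Proof.
move=> r0 rk rn p1; have n0 : (0 < n)%N by exact: leq_trans rn.
apply: (radius_gt0 r0 n0 p1 (y := const_mx 1)).
rewrite /polyform mulr_gt0 ?ltr0n ?fact_gt0//.
pose e : {set 'I_n} := [set widen_ord rn i | i in [set: 'I_r]]%SET.
have er : #|e| = r.
  rewrite card_imset ?cardsT ?card_ord// => i i' /(congr1 val) /= ii'.
  exact: val_inj.
have eT : e \in edges (turan k r n).
  rewrite inE er eqxx /=; apply/forallP => j; apply/card_le1_eqP => i i'.
  rewrite !inE => /andP[/imsetP[l _ ->] /eqP lj] /andP[/imsetP[l' _ ->] /eqP l'j].
  apply/val_inj => /=; move: lj l'j => /=.
  by rewrite !modn_small ?(leq_trans (ltn_ord _) rk)// => -> ->.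
rewrite (bigD1 e)//=; apply: ltr_wpDr.
  by apply: sumr_ge0 => e' _; apply: prodr_ge0 => i _; rewrite mxE.
by apply: prodr_gt0 => i _; rewrite mxE.
Qed.

Theorem theorem2 (R : realType) (k r n : nat) (G : uhypergraph r n) (p : R) :
  (2 <= r)%N -> (r <= k)%N -> kpartite k G -> 1 < p ->
  ~ uhypergraph_iso G (turan k r n) ->
  pspectral_radius p G < pspectral_radius p (turan k r n).
Proof.
move=> r2 rk [V [/kpartition_fibre[c ->{V}] cG]] p1 GT.
(* For [n < r] there are no edges at all, and the identity is an isomorphism onto the Turan
   graph. *)
have [rn|nr] := leqP r n; last first.
  have edges0 (H : uhypergraph r n) : edges H = finset.set0.
    apply/setP => e; rewrite inE; apply/negP => /edges_uniform er.
    by have := max_card (mem e); rewrite card_ord er leqNgt nr.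
  by case: GT; exists 1%g; rewrite !edges0 imset0.
have n0 : (0 < n)%N by lia.
have r0 : (0 < r)%N by lia.
have lamT := turan_radius_gt0 r0 rk rn p1.
have [d dT] := kpartition_fibre (@kpartition_turan k n (leq_trans r0 rk)).
have bd := turan_part_balanced dT.
have TE : turan k r n = multipartite r d by rewrite /turan dT.
case: r r2 r0 {rk rn} => [//|[//|m]] _ _ in G cG GT lamT TE *.
rewrite TE in GT lamT *.
(* Finite functions are used so that a colouring [f] of largest radius exists. *)
pose lam (f : {ffun 'I_n -> 'I_k}) := pspectral_radius p (multipartite m.+2 f).
have lamE (f : 'I_n -> 'I_k) : pspectral_radius p (multipartite m.+2 f) = lam [ffun i => f i].
  by rewrite /lam; congr (pspectral_radius p (multipartite _ _)); apply/funext => i; rewrite ffunE.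
have [f _ fmax] := @Order.TotalTheory.arg_maxP _ _ _ [ffun i => d i] xpredT lam isT.
have lamf (f' : 'I_n -> 'I_k) : pspectral_radius p (multipartite m.+2 f') <= lam f.
  by rewrite lamE; exact: fmax.
have maximal_balanced (f' : 'I_n -> 'I_k) :
    lam f <= pspectral_radius p (multipartite m.+2 f') -> balanced f'.
  move=> ff' a b; rewrite leqNgt; apply/negP => ab.
  have f'0 : 0 < pspectral_radius p (multipartite m.+2 f').
    exact: lt_le_trans (le_trans (lamf d) ff').
  have [f'' f'f''] := unbalanced_not_maximal n0 p1 f'0 ab.
  by have := lt_le_trans f'f'' (lamf f''); rewrite ltNge ff'.
(* The best colouring [f] is balanced, hence isomorphic to the Turan colouring [d], which therefore
   attains the maximum as well. *)
have dlam : pspectral_radius p (multipartite m.+2 d) = lam f.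
  apply/esym/iso_radius/balanced_iso => //; exact: maximal_balanced.
rewrite dlam; have GK : edges G \subset edges (multipartite m.+2 c).
  by apply/fintype.subsetP => e eG; rewrite inE (edges_uniform eG) eqxx cG.
have GKlam := subgraph_radius_le n0 p1 GK.
(* Equality would make [c] optimal, hence balanced, with a graph isomorphic to the Turan graph. Then
   [G] is a proper subgraph of it, being itself not isomorphic to the Turan graph, and its radius is
   strictly smaller. *)
rewrite lt_neqAle (le_trans GKlam (lamf c)) andbT; apply/eqP => Glam.
have cmax : lam f <= pspectral_radius p (multipartite m.+2 c) by rewrite -Glam.
have [s sE] := balanced_iso m.+2 (maximal_balanced c cmax) bd.
have GKp : edges G \proper edges (multipartite m.+2 c).
  rewrite finset.properEneq GK andbT; apply/eqP => GKE.
  by apply: GT; exists s; rewrite GKE.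
have c0 : 0 < pspectral_radius p (multipartite m.+2 c).
  exact: lt_le_trans (le_trans (lamf d) cmax).
have := proper_subgraph_radius_lt n0 p1 GKp c0.
by rewrite Glam ltNge lamf.
Qed.
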